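(* Let $m\ge 1$ be an integer with $\gcd(3,m)=1$, let $\Bbbk$ be a field, and let $T=\Bbbk[x_1,x_2,x_3]$ be graded by the weights $\operatorname{wt}(x_1)=3$, $\operatorname{wt}(x_2)=3+m$, $\operatorname{wt}(x_3)=3+2m$. Let $\mathfrak p\subset T$ be the defining ideal of the monomial curve parametrized by $(t^{3},t^{3+m},t^{3+2m})$. Then: (1) $\alpha(\mathfrak p)=2m+6$. (2) $\gamma(\mathfrak p)=\begin{cases}15/2 & \text{if } m=1,\\ 2m+6 & \text{if } m>1.\end{cases}$
   Context: $\mathfrak p$ is the kernel of the $\Bbbk$-algebra map $T\to\Bbbk[t]$, $x_1\mapsto t^3$, $x_2\mapsto t^{3+m}$, $x_3\mapsto t^{3+2m}$; it and its symbolic powers $\mathfrak p^{(n)}=\mathfrak p^nT_{\mathfrak p}\cap T$ are homogeneous for the weighted grading. For a nonzero weighted homogeneous ideal $I$, $\alpha(I)=\min\{n: I_n\ne 0\}$ is the least weighted degree of a nonzero homogeneous element of $I$, and the Waldschmidt constant is $\gamma(I)=\lim_{n\to\infty}\alpha(I^{(n)})/n$. *)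

(* Defs.v *)
From HB Require Import structures.
From mathcomp Require Import all_boot all_order all_algebra.
From mathcomp Require Import all_classical all_reals all_analysis.
(* The notations of mpoly clash with those of MathComp-Analysis. *)
From mathcomp Require mpoly.
Import -(notations) mpoly.

Set Implicit Arguments.
Unset Strict Implicit.
Unset Printing Implicit Defensive.

Import Order.TTheory GRing.Theory Num.Theory.
Import numFieldNormedType.Exports.

Local Open Scope classical_set_scope.
Local Open Scope ring_scope.

Notation "{ 'mpoly' T [ n ] }" := (mpoly.mpoly n T) : type_scope.

(* The set of finite sums of the c * g with c in S and g in G.  For S = setT it
   is the ideal generated by G; for a subring S of A it is the S-submodule of A
   generated by G. *)
Definition span_over (A : comNzRingType) (S G : set A) : set A :=
  [set x | exists (r : nat) (c g : 'I_r -> A),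
     [/\ forall i, S (c i), forall i, G (g i) & x = \sum_(i < r) c i * g i]].

Definition ideal_pow (A : comNzRingType) (I : set A) (n : nat) : set A :=
  span_over setT
    [set x | exists g : 'I_n -> A,
       (forall i, I (g i)) /\ x = \prod_(i < n) g i].

(* The localization A_P of a domain A at a prime ideal P, as a subring of the
   fraction field of A. *)
Definition localization (A : idomainType) (P : set A) : set {fraction A} :=
  [set z | exists a s : A,
     ~ P s /\ z = FracField.tofrac a / FracField.tofrac s].

(* P^(n) = P^n A_P `&` A *)
Definition symbolic_power (A : idomainType) (P : set A) (n : nat) : set A :=
  @FracField.tofrac A @^-1`
    span_over (localization P) (@FracField.tofrac A @` ideal_pow P n).

Section Weighted.
Variables (n : nat) (w : 'I_n -> nat).

Definition wdeg (u : mpoly.multinom n) : nat := (\sum_(i < n) u i * w i)%N.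

Lemma wdeg0 : wdeg (mpoly.mnm0 (n := n)) = 0%N.
Proof. by rewrite /wdeg big1 // => i _; rewrite mpoly.mnm0E. Qed.

Lemma wdegD : {morph wdeg : u v / mpoly.mnm_add u v >-> (u + v)%N}.
Proof.
move=> u v; rewrite /wdeg -big_split; apply: eq_bigr => i _ /=.
by rewrite mpoly.mnmDE mulnDl.
Qed.

HB.instance Definition _ := mpoly.isMeasure.Build n wdeg wdeg0 wdegD.

Variable k : fieldType.

Definition graded_piece (I : set {mpoly k[n]}) (d : nat) : set {mpoly k[n]} :=
  [set f | I f /\ f \is mpoly.ishomog1 d wdeg].

Definition has_nonzero_piece (I : set {mpoly k[n]}) (d : nat) : Prop :=
  exists2 f, graded_piece I d f & f != 0.

(* The least d with I_d != 0; the junk value 0 occurs only when all I_d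
   vanish. *)
Definition alpha (I : set {mpoly k[n]}) : nat :=
  xget 0%N [set d | has_nonzero_piece I d /\
                    forall e, has_nonzero_piece I e -> (d <= e)%N].

(* The term of index 0 is the junk value alpha(I^(0)) / 0 = 0. *)
Definition waldschmidt_seq (R : realType) (I : set {mpoly k[n]}) : R^nat :=
  fun r => (alpha (symbolic_power I r))%:R / r%:R.

Definition waldschmidt (R : realType) (I : set {mpoly k[n]}) : R :=
  limn (waldschmidt_seq R I).

(* The kernel of the k-algebra map k[x_0, ..., x_(n-1)] -> k[t] that sends x_i
   to t^(w i). *)
Definition monomial_curve_ideal : set {mpoly k[n]} :=
  [set f | mpoly.mmap (@polyC k) (fun i => 'X^(w i)) f = 0].

End Weighted.

Arguments monomial_curve_ideal {n} w k _.

(* The weights 3, 3 + m, 3 + 2m. *)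
Definition curve_weight (m : nat) (i : 'I_3) : nat := (3 + i * m)%N.

(* Main.v *)
(* Substitute x = t^3 v^(2m) (1 + (t-1)(v-1)), y = t^(3+m) v^(2m+C) and
   z = t^(3+2m) v^(2m+2C), where 3C = 2m^2 + 1.  At v = 1 this is the monomial
   curve, so every f in p^(n) becomes divisible by (v-1)^n, while y^2 - xz
   becomes divisible by v-1 only once.  At t = 1 a form f of weight d becomes a
   polynomial in v whose exponents lie in an interval of length 2d/(3(2m+3)).
   If it is nonzero, divisibility by (v-1)^n gives 3(2m+3)n <= 2d; if it is zero,
   y^2 - xz divides f and one concludes by induction on n.  Hence
   n min(4m+12, 6m+9) <= 2d.  The bound is attained, up to rounding, by powers of
   y^2 - xz and, when m = 1, by powers of an element of weight 15 of p^(2). *)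
Require Import Defs.
From mathcomp Require Import all_boot all_order all_algebra.
From mathcomp Require Import all_classical all_reals all_analysis.
From mathcomp Require mpoly.
From mathcomp Require Import ring lra zify.
Import -(notations) mpoly.
Import Order.TTheory GRing.Theory Num.Theory.
Import numFieldNormedType.Exports.
Local Open Scope classical_set_scope.
Local Open Scope ring_scope.

(** * Powers and symbolic powers of an ideal *)

Section IdealPowers.
Variables (A : comNzRingType) (P : set A).

Lemma span_overD (S G : set A) x y :
  span_over S G x -> span_over S G y -> span_over S G (x + y).
Proof.
move=> [r [c [g [Sc Gg ->]]]] [r' [c' [g' [Sc' Gg' ->]]]].
exists (r + r')%N.
exists (fun i => match fintype.split i with inl j => c j | inr j => c' j end).
exists (fun i => match fintype.split i with inl j => g j | inr j => g' j end).
split=> [i|i|]; try by case: fintype.split.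
rewrite big_split_ord; congr (_ + _); apply: eq_bigr => i _.
  by rewrite (unsplitK (inl _ i)).
by rewrite (unsplitK (inr _ i)).
Qed.

Lemma ideal_powD n f g :
  ideal_pow P n f -> ideal_pow P n g -> ideal_pow P n (f + g).
Proof. exact: span_overD. Qed.

Lemma ideal_powZ n a f : ideal_pow P n f -> ideal_pow P n (a * f).
Proof.
move=> [r [c [g [_ Gg ->]]]]; exists r, (fun i => a * c i), g; split=> //.
by rewrite mulr_sumr; apply: eq_bigr => i _; rewrite mulrA.
Qed.

Lemma ideal_pow_nil n : ideal_pow P n 0.
Proof.
by exists 0%N, (fun=> 0), (fun=> 0); split; rewrite ?big_ord0 //; case.
Qed.

Lemma ideal_pow0 : ideal_pow P 0 1.
Proof.
exists 1%N, (fun=> 1), (fun=> 1); split=> // [_|].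
  by exists (fun=> 1); split; [case | rewrite big_ord0].
by rewrite big_ord1 mulr1.
Qed.

Lemma ideal_powM n f h : ideal_pow P n f -> P h -> ideal_pow P n.+1 (f * h).
Proof.
move=> [r [c [g [_ Gg ->]]]] Ph; exists r, c, (fun i => g i * h); split=> //.
  move=> i; have [u [Pu ->]] := Gg i.
  exists (fun j => if unlift ord_max j is Some j' then u j' else h).
  split=> [j|]; first by case: unlift.
  rewrite big_ord_recr /= unlift_none; congr (_ * _); apply: eq_bigr => j _.
  have -> : widen_ord (leqnSn n) j = lift ord_max j.
    by apply: val_inj; rewrite /= /bump leqNgt ltn_ord.
  by rewrite liftK.
by rewrite mulr_suml; apply: eq_bigr => i _; rewrite mulrA.
Qed.

Lemma ideal_pow_expr h n : P h -> ideal_pow P n (h ^+ n).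
Proof.
move=> Ph; elim: n => [|n IHn]; first exact: ideal_pow0.
by rewrite exprSr; apply: ideal_powM.
Qed.

(** A product of [n] elements of [P] contributes one factor [pi] per element. This turns membership
    in a power into divisibility. *)
Lemma ideal_pow_rmorph_dvd (B : comNzRingType) (phi : {rmorphism A -> B})
    (pi : B) n f :
  (forall g, P g -> exists q, phi g = q * pi) ->
  ideal_pow P n f -> exists q, phi f = q * pi ^+ n.
Proof.
move=> Ppi [r [c [g [_ Gg ->]]]]; rewrite rmorph_sum.
elim/big_ind: _ => [|_ _ [q1 ->] [q2 ->]|i _].
- by exists 0; rewrite mul0r.
- by exists (q1 + q2); rewrite mulrDl.
have [u [Pu ->]] := Gg i; rewrite rmorphM rmorph_prod.
suff [q ->] : exists q, \prod_(j < n) phi (u j) = q * pi ^+ n.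
  by exists (phi (c i) * q); rewrite mulrA.
elim: n u Pu {Gg} => [|n IHn] u Pu.
  by exists 1; rewrite big_ord0 mulr1.
rewrite big_ord_recr /=.
have [q ->] := IHn (fun j => u (widen_ord (leqnSn n) j)) (fun=> Pu _).
have [q' ->] := Ppi _ (Pu ord_max).
by exists (q * q'); rewrite exprSr; ring.
Qed.

End IdealPowers.

(** Denominators lie outside [P], and so do their products by the third hypothesis, so a finite sum
    of fractions has a common denominator [s]. *)
Lemma symbolic_powerP (A : idomainType) (P : set A) n f :
    P 0 -> ~ P 1 -> (forall a b, ~ P a -> ~ P b -> ~ P (a * b)) ->
  symbolic_power P n f <-> exists2 s, ~ P s & ideal_pow P n (s * f).
Proof.
move=> P0 P1 PM; have nz s : ~ P s -> FracField.tofrac s != 0.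
  by move=> Ps; rewrite tofrac_eq0; apply/eqP => s0; rewrite s0 in Ps.
split=> [[r [c [g [Sc Gg Ef]]]]|[s Ps Isf]]; last first.
  exists 1%N, (fun=> FracField.tofrac 1 / FracField.tofrac s).
  exists (fun=> FracField.tofrac (s * f)); split=> [_|_|].
  - by exists 1, s.
  - by exists (s * f).
  by rewrite big_ord1 tofrac1 tofracM mul1r mulKf ?nz.
suff [s [b [Ps Ib Esb]]] : exists s b, [/\ ~ P s, ideal_pow P n b &
    FracField.tofrac s * FracField.tofrac f = FracField.tofrac b].
  exists s => //; move: Esb; rewrite -tofracM => /eqP.
  by rewrite tofrac_eq => /eqP ->.
rewrite Ef; elim/big_ind: _ => [|x y [s1 [b1 [P1' I1 E1]]]|i _].
- by exists 1, 0; split=> //; [exact: ideal_pow_nil | rewrite mulr0 tofrac0].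
- move=> [s2 [b2 [P2 I2 E2]]]; exists (s1 * s2), (s2 * b1 + s1 * b2); split.
  + exact: PM.
  + by apply: ideal_powD; apply: ideal_powZ.
  by rewrite tofracD !tofracM -E1 -E2; ring.
have [a [s [Ps ->]]] := Sc i; have [b Ib <-] := Gg i.
exists s, (a * b); split=> //; first exact: ideal_powZ.
by rewrite tofracM mulrA mulrCA mulfV ?nz // mulr1.
Qed.

(** * Least degrees, a limit, and univariate polynomials *)

Lemma alphaP n (w : 'I_n -> nat) (k : fieldType) (I : set {mpoly k[n]}) d :
  has_nonzero_piece w I d ->
  has_nonzero_piece w I (alpha w I) /\ (alpha w I <= d)%N.
Proof.
move=> Id; rewrite /alpha; case: xgetP => [a _ [Ia mina]|none].
  by split=> //; apply: mina.
(* Well-ordering gives a minimum, which excludes the default value of [xget]. *)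
have exd : exists d, `[< has_nonzero_piece w I d >] by exists d; apply/asboolP.
case: (ex_minnP exd) => a /asboolP Ia mina; have [] := none a.
by split=> // e Ie; apply: mina; apply/asboolP.
Qed.

Lemma cvg_ratio_half (R : realType) (a : nat -> nat) (M : nat) :
    (forall n, n * M <= 2 * a n <= n * M + 1)%N ->
  (fun n => (a n)%:R / n%:R : R) @ \oo --> (M%:R / 2 : R).
Proof.
(* Shifting the index discards the junk term at 0 and makes the denominators nonzero. *)
move=> aM; rewrite -cvg_shiftS /=.
apply: (@squeeze_cvgr _ _ _ _ (fun=> M%:R / 2) (fun n => M%:R / 2 + harmonic n)).
- apply: nearW => n; have /andP[] := aM n.+1.
  rewrite -!(ler_nat R) natrD !natrM /= => lo hi.
  have n0 : (0 : R) < n.+1%:R by rewrite ltr0n.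
  by rewrite ler_pdivlMr // ler_pdivrMr // mulrDl mulVf ?gt_eqF //; apply/andP; split; lra.
- exact: cvg_cst.
rewrite -[X in _ --> X]addr0; apply: cvgD; first exact: cvg_cst.
exact: cvg_harmonic.
Qed.

(** As [a] does not vanish at 1, the prime ['X - 1%:P] does not divide it, so all these factors come
    from [b]; they are removed one at a time. *)
Lemma cancel_factor_subX1 (R : idomainType) (a b q : {poly R}) n :
  a.[1] != 0 -> a * b = q * ('X - 1%:P) ^+ n ->
  exists r, b = r * ('X - 1%:P) ^+ n.
Proof.
move=> a1; elim: n b q => [|n IHn] b q Eab; first by exists b; rewrite mulr1.
have /factor_theorem[b' Eb] : root b 1.
  have /eqP := congr1 (horner^~ 1) Eab.
  rewrite /= exprSr !hornerM hornerXsubC subrr !mulr0 mulf_eq0 (negPf a1).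
  by [].
have nz : ('X - 1%:P : {poly R}) != 0 by rewrite polyXsubC_eq0.
have [|r Er] := IHn b' q; last by exists r; rewrite Eb Er exprSr mulrA.
by apply: (mulIf nz); rewrite -mulrA -Eb Eab exprSr mulrA.
Qed.

(** The powers of ['X] form a basis, so the linear map sending each ['X^j] to [L j] carries the
    relation over. *)
Lemma sum_scaleXn_eq0 (R : nzRingType) (V : lmodType R) (I : eqType)
    (s : seq I) (c : I -> R) (e : I -> nat) (L : nat -> V) :
  \sum_(u <- s) c u *: 'X^(e u) = 0 -> \sum_(u <- s) c u *: L (e u) = 0.
Proof.
move=> s0; pose N := (\max_(u <- s) e u).+1.
transitivity (\sum_(i < N) (\sum_(u <- s) c u *: 'X^(e u))`_i *: L i).
  under [RHS]eq_bigr do rewrite coef_sum scaler_suml.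
  rewrite exchange_big /=; apply: eq_big_seq => u su.
  have ltN : (e u < N)%N by rewrite ltnS; apply: leq_bigmax_seq.
  rewrite (bigD1 (Ordinal ltN)) //= coefZ coefXn eqxx mulr1 big1 ?addr0 //.
  move=> i; rewrite -val_eqE /= => /negPf ni.
  by rewrite coefZ coefXn ni mulr0 scale0r.
by rewrite s0 big1 // => i _; rewrite coef0 scale0r.
Qed.

(** * Ring maps sending variables to monomials *)

Section MonomialMaps.
Variables (n : nat) (k : fieldType).
Implicit Types (w : 'I_n -> nat) (f : {mpoly k[n]}).

Lemma rmorph_mmap (S S' : comNzRingType) (phi : {rmorphism S -> S'})
    (c : {rmorphism k -> S}) (h : 'I_n -> S) f :
  phi (mmap c h f) = mmap (phi \o c) (phi \o h) f.
Proof.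
rewrite /mmap rmorph_sum; apply: eq_bigr => u _.
by rewrite rmorphM rmorph_prod; under eq_bigr do rewrite rmorphXn.
Qed.

Lemma eq_mmap (S : comNzRingType) (c c' : k -> S) (h h' : 'I_n -> S) f :
  c =1 c' -> h =1 h' -> mmap c h f = mmap c' h' f.
Proof.
move=> Ec Eh; apply: eq_bigr => u _; rewrite Ec; congr (_ * _).
by apply: eq_bigr => i _; rewrite Eh.
Qed.

Lemma mmap_XnE w f :
  mmap (@polyC k) (fun i => 'X^(w i)) f =
  \sum_(u <- msupp f) mcoeff u f *: 'X^(wdeg w u).
Proof.
apply: eq_bigr => u _; rewrite mul_polyC; congr (_ *: _).
rewrite /mmap1 /wdeg -prodrXr; apply: eq_bigr => i _.
by rewrite -exprM mulnC.
Qed.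

Lemma mpolyX_homog w i : mpolyX k (mnm1 i) \is ishomog1 (w i) (wdeg w).
Proof.
rewrite dhomogX /= /wdeg (bigD1 i) //= mnm1E eqxx mul1n big1 ?addn0 // => j ji.
by rewrite mnm1E eq_sym (negPf ji).
Qed.

End MonomialMaps.

(** * The monomial curve, the conic and the substitution *)

Section MonomialCurve.
Variables (k : fieldType) (m : nat).
Hypothesis co3m : coprime 3 m.
Implicit Types f g : {mpoly k[3]}.

Let w := curve_weight m.
Let p : set {mpoly k[3]} := monomial_curve_ideal w k.
(** The division is exact by [C3], so three times [e i] is [2 * m * w i + i]: on forms of fixed
    weight only the part [i] matters. *)
Let C := ((2 * m ^ 2 + 1) %/ 3)%N.
Let e (i : 'I_3) : nat := (2 * m + i * C)%N.

Let i1 : 'I_3 := @Ordinal 3 1 isT.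
Let i2 : 'I_3 := @Ordinal 3 2 isT.
Let x : {mpoly k[3]} := mpolyX k (mnm1 ord0).
Let y : {mpoly k[3]} := mpolyX k (mnm1 i1).
Let z : {mpoly k[3]} := mpolyX k (mnm1 i2).
Let conic : {mpoly k[3]} := y ^+ 2 - x * z.

(** As 3 does not divide [m], the square of [m] is 1 modulo 3. *)
Let C3 : (C * 3 = 2 * m ^ 2 + 1)%N.
Proof.
apply/eqP; rewrite -dvdn_eq /dvdn.
have : (m %% 3 != 0)%N by rewrite -prime_coprime.
have : (m %% 3 < 3)%N by rewrite ltn_mod.
rewrite -modnDml -modnMmr -modnXm.
by case: (m %% 3)%N => [|[|[|]]].
Qed.

Let wdeg3 (v : 'I_3 -> nat) u :
  wdeg v u = (u ord0 * v ord0 + u i1 * v i1 + u i2 * v i2)%N.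
Proof.
rewrite /wdeg !big_ord_recl big_ord0 addn0 addnA.
by congr (_ + u _ * v _ + u _ * v _)%N; apply: val_inj.
Qed.

Let mpolyX3 u : mpolyX k u = x ^+ u ord0 * y ^+ u i1 * z ^+ u i2.
Proof.
rewrite mpolyXE_id !big_ord_recl big_ord0 mulr1 mulrA.
by congr (_ * mpolyX _ (mnm1 _) ^+ u _ * mpolyX _ (mnm1 _) ^+ u _);
  apply: val_inj.
Qed.

Let x_homog : x \is ishomog1 3 (wdeg w).
Proof. exact: mpolyX_homog. Qed.

Let y_homog : y \is ishomog1 (3 + m) (wdeg w).
Proof. by have := mpolyX_homog 3 k w i1; rewrite {1}/w /curve_weight mul1n. Qed.

Let z_homog : z \is ishomog1 (3 + 2 * m) (wdeg w).
Proof. exact: mpolyX_homog. Qed.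

Lemma conic_homog : conic \is ishomog1 (2 * m + 6) (wdeg w).
Proof.
apply: rpredB.
  have -> : (2 * m + 6 = (3 + m) * 2)%N by lia.
  exact: dhomogMn.
have -> : (2 * m + 6 = 3 + (3 + 2 * m))%N by lia.
exact: dhomogM.
Qed.

Let wdeg_e u : (3 * wdeg e u = 2 * m * wdeg w u + (u i1 + 2 * u i2))%N.
Proof. by rewrite !wdeg3 /e /w /curve_weight /=; nia. Qed.

Let psi f := mmap (@polyC k) (fun i => 'X^(e i)) f.

(** Modulo [conic], each monomial has a normal form with exponent of [y] at most 1. In weight [d]
    this form depends only on the exponent of the image under [psi], so the normal forms sum to 0
    and [f] is a sum of multiples of [conic]. *)
Lemma conic_dvd d f : f \is ishomog1 d (wdeg w) -> psi f = 0 ->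
  exists2 g, g \is ishomog1 (d - (2 * m + 6)) (wdeg w) & f = conic * g.
Proof.
move=> homf psif.
pose N (a b c : nat) : {mpoly k[3]} := x ^+ a * y ^+ b * z ^+ c.
pose Nu (u : multinom 3) : {mpoly k[3]} :=
  N (u ord0 + (u i1)./2)%N (odd (u i1)) (u i2 + (u i1)./2)%N.
(* The normal form in weight [d] with j = [u i1 + 2 * u i2]. The weight is 3 times the total degree
   plus mj, so the quotient by 3 is the total degree. *)
pose L (j : nat) : {mpoly k[3]} :=
  N ((d - m * j) %/ 3 - odd j - j./2)%N (odd j) j./2.
(* The cofactor of [conic] in the monomial [u] minus [Nu u], from the factorization of a difference
   of equal powers of y^2 and xz. *)
pose g (u : multinom 3) : {mpoly k[3]} :=
  x ^+ u ord0 * y ^+ odd (u i1) * z ^+ u i2 *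
  \sum_(i < (u i1)./2) (y ^+ 2) ^+ ((u i1)./2.-1 - i) * (x * z) ^+ i.
have degu u : u \in msupp f -> wdeg w u = d.
  by move/dhomogP: homf; apply.
have NuL : \sum_(u <- msupp f) mcoeff u f *: Nu u = 0.
  (* By [wdeg_e], [3 * i - 2 * m * d] recovers j from the exponent i under [psi]. *)
  rewrite -[RHS](@sum_scaleXn_eq0 _ _ _ (msupp f) (fun u => mcoeff u f) (wdeg e)
    (fun i => L (3 * i - 2 * m * d)%N)) -?mmap_XnE //.
  apply: eq_big_seq => u uf; congr (_ *: _).
  have -> : (3 * wdeg e u - 2 * m * d = u i1 + 2 * u i2)%N.
    by rewrite wdeg_e degu // addKn.
  rewrite /Nu /L; have := degu _ uf; rewrite wdeg3 /w /curve_weight /= => <-.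
  rewrite oddD oddM addbF; congr N.
    have -> : (u ord0 * (3 + 0 * m) + u i1 * (3 + 1 * m) + u i2 * (3 + 2 * m)
      - m * (u i1 + 2 * u i2) = (u ord0 + u i1 + u i2) * 3)%N by nia.
    by rewrite mulnK //; clear; lia.
  by clear; lia.
exists (\sum_(u <- msupp f) mcoeff u f *: g u).
  rewrite big_seq; apply: rpred_sum => u uf; apply: rpredZ.
  rewrite /g mulr_sumr; apply: rpred_sum => i _.
  (* The subtraction is not truncated: a summand exists only if [(u i1)./2] is positive, and then
     [d] is at least the weight of y^2. *)
  have -> : (d - (2 * m + 6) =
      (3 * u ord0 + (3 + m) * odd (u i1) + (3 + 2 * m) * u i2) +
      ((3 + m) * 2 * ((u i1)./2.-1 - i) + (3 + (3 + 2 * m)) * i))%N.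
    have := degu _ uf; rewrite wdeg3 /w /curve_weight /= => <-.
    rewrite -{1}(odd_double_half (u i1)) -mul2n.
    have := ltn_ord i; case: (u i1)./2 (nat_of_ord i) => // h j /= jh.
    by rewrite -(subnK (m := j) (n := h)) //; nia.
  apply: dhomogM; last by apply: dhomogM; do ?[exact: dhomogM | apply: dhomogMn].
  by apply: dhomogM; [apply: dhomogM|]; apply: dhomogMn.
have Ef : f = \sum_(u <- msupp f) mcoeff u f *: mpolyX k u -
    \sum_(u <- msupp f) mcoeff u f *: Nu u by rewrite NuL subr0 -mpolyE.
rewrite [LHS]Ef -sumrB mulr_sumr.
apply: eq_bigr => u _; rewrite -scalerBr -scalerAr; congr (_ *: _).
rewrite /g mulrCA -subrXX mpolyX3 /Nu /N.
rewrite -[in y ^+ u i1](odd_double_half (u i1)) -muln2.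
move: (u ord0) (odd _) (u i2) (u i1)./2 => a b c h.
by rewrite exprD exprM [y ^+ 2 ^+ h]exprAC !exprD [(x * z) ^+ h]exprMn; ring.
Qed.

(* With [t = 1] on the coefficients, [h] becomes the arc [psi] inside the
   surface [conic = 0]; with [v = 1] it becomes the monomial curve. *)
Let h (i : 'I_3) : {poly {poly k}} := ('X^(w i))%:P * 'X^(e i) *
  (if i == ord0 then 1 + ('X - 1%:P)%:P * ('X - 1%:P) else 1).
Let theta f := mmap (polyC \o polyC) h f.

Let theta_v1 f : (theta f).[1] = mmap (@polyC k) (fun i => 'X^(w i)) f.
Proof.
rewrite -horner_evalE /theta rmorph_mmap; apply: eq_mmap => [c|i] /=.
  by rewrite horner_evalE hornerC.
rewrite horner_evalE /h !hornerM hornerC horner_exp hornerX expr1n mulr1.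
case: ifP => _; last by rewrite hornerC mulr1.
by rewrite hornerD hornerM hornerXsubC subrr mulr0 addr0 hornerC mulr1.
Qed.

Let pP f : p f <-> (theta f).[1] = 0.
Proof. by rewrite theta_v1. Qed.

Let theta_t1 f : map_poly (horner_eval 1) (theta f) = psi f.
Proof.
rewrite /theta rmorph_mmap; apply: eq_mmap => [c|i] /=.
  by rewrite map_polyC /= horner_evalE hornerC.
rewrite /h; move: (w i) (e i) => a b.
rewrite !rmorphM /= map_polyC /= map_polyXn horner_evalE hornerXn expr1n.
rewrite mul1r; case: ifP => _; last by rewrite rmorph1 mulr1.
rewrite rmorphD rmorph1 rmorphM /= map_polyC /= horner_evalE hornerXsubC subrr.
by rewrite mul0r addr0 mulr1.
Qed.

(** The images of y^2 and xz have the same monomial part and differ only by the factor 1 +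
    (t-1)(v-1). *)
Let theta_conic :
  theta conic = - (('X^(2 * m + 6) * ('X - 1%:P))%:P * 'X^(2 * (2 * m + C))) *
                ('X - 1%:P).
Proof.
have -> : theta conic = h i1 ^+ 2 - h ord0 * h i2.
  by rewrite /theta rmorphB rmorphXn rmorphM /= !mmapX !mmap1U.
rewrite /h eqxx (_ : (i1 == ord0) = false) // (_ : (i2 == ord0) = false) //.
rewrite /w /e /curve_weight mul0n mul1n (_ : nat_of_ord i2 = 2) // !addn0.
rewrite mul1n !mul2n -!addnn !exprD !polyCM; ring.
Qed.

(** * Lower bound for weights in the symbolic powers *)

Let p0 : p 0. Proof. by apply/pP; rewrite /theta rmorph0 horner0. Qed.

Let p1 : ~ p 1.
Proof. by rewrite pP /theta rmorph1 hornerC; apply/eqP; rewrite oner_eq0. Qed.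

Let pM a b : ~ p a -> ~ p b -> ~ p (a * b).
Proof.
rewrite !pP /theta rmorphM hornerM => /eqP a0 /eqP b0.
by apply/eqP; rewrite mulf_neq0.
Qed.

(** A multiplier [s] outside [p] has [theta s] nonzero at v = 1, so the n factors v - 1 of the image
    of [s * f] belong to [theta f]. *)
Lemma theta_symbolic_power n f : symbolic_power p n f ->
  exists q, theta f = q * ('X - 1%:P) ^+ n.
Proof.
move=> /(symbolic_powerP _ _ _ _ p0 p1 pM)[s ps Isf].
have s1 : (theta s).[1] != 0 by apply/eqP => /pP.
have [|q Eq] := ideal_pow_rmorph_dvd _ p _ (mmap (polyC \o polyC) h)
  ('X - 1%:P) n (s * f) _ Isf.
  by move=> g /pP/eqP/factor_theorem.
by apply: (cancel_factor_subX1 _ _ _ q _ s1); rewrite -Eq [RHS]rmorphM.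
Qed.

(** Assuming divisibility of [theta f], not membership in a symbolic power, lets the induction pass
    to the quotient by [conic]. The terms of the minimum come from the cases [psi f = 0] and
    [psi f != 0] respectively. *)
Lemma weight_lower_bound n f d q : f != 0 -> f \is ishomog1 d (wdeg w) ->
    theta f = q * ('X - 1%:P) ^+ n ->
  (n * minn (4 * m + 12) (6 * m + 9) <= 2 * d)%N.
Proof.
elim: n f d q => [|n IHn] f d q f0 homf Ef; first by rewrite mul0n.
have [psif|psif] := eqVneq (psi f) 0.
  have [g homg Efg] := conic_dvd _ _ homf psif.
  have g0 : g != 0 by apply: contraNneq f0 => g0; rewrite Efg g0 mulr0.
  (* Since [f] is nonzero, the subtraction in [conic_dvd] is exact. *)
  have Ed : d = (2 * m + 6 + (d - (2 * m + 6)))%N.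
    apply: (dhomog_uniq f0 homf); rewrite Efg; apply: dhomogM homg.
    exact: conic_homog.
  have v1 : ('X - 1%:P : {poly {poly k}}) != 0 by rewrite polyXsubC_eq0.
  pose c : {poly {poly k}} :=
    - (('X^(2 * m + 6) * ('X - 1%:P))%:P * 'X^(2 * (2 * m + C))).
  have c1 : c.[1] != 0.
    rewrite hornerN oppr_eq0 hornerM hornerC hornerXn expr1n mulr1.
    by rewrite mulf_neq0 ?expf_neq0 ?polyX_eq0 ?polyXsubC_eq0.
  have [|r /IHn-/(_ _ g0 homg)] := cancel_factor_subX1 _ c (theta g) q n c1.
    apply: (mulIf v1); rewrite -[RHS]mulrA -exprSr -Ef Efg.
    have -> : theta (conic * g) = theta conic * theta g by rewrite /theta rmorphM.
    by rewrite theta_conic /c; ring.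
  have := geq_minl (4 * m + 12) (6 * m + 9); set M := minn _ _.
  by move: Ed; rewrite mulSn; clear; lia.
(* By [wdeg_e] the exponents in [psi f] are at least 2md/3; [e0] is its ceiling. *)
pose e0 := ((2 * m * d + 2) %/ 3)%N.
pose G := \sum_(u <- msupp f) mcoeff u f *: 'X^(wdeg e u - e0).
have degu u : u \in msupp f -> wdeg w u = d by move/dhomogP: homf; apply.
have EG : psi f = 'X^e0 * G.
  rewrite /psi mmap_XnE mulr_sumr; apply: eq_big_seq => u uf.
  rewrite -scalerAr -exprD subnKC //.
  by have := wdeg_e u; rewrite degu // /e0; clear; lia.
have [||r EGr] := cancel_factor_subX1 _ 'X^e0 G (map_poly (horner_eval 1) q) n.+1.
- by rewrite hornerXn expr1n oner_neq0.
- rewrite -EG -theta_t1 Ef rmorphM rmorphXn rmorphB /= map_polyX map_polyC /=.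
  by rewrite horner_evalE hornerC.
(* If all exponents in [G] were at most [n], then [G] could not be a nonzero multiple of a
   polynomial of degree [n.+1]. *)
have [allu|] := altP (@allP _ (fun u => wdeg e u - e0 < n.+1)%N (msupp f)).
  have : (size G <= n.+1)%N.
    apply: leq_trans (size_sum _ _ _) _; apply/bigmax_leqP_seq => u uf _.
    by apply: leq_trans (size_scale_leq _ _) _; rewrite size_polyXn allu.
  have r0 : r != 0.
    apply: contraNneq psif => r0; by rewrite EG EGr r0 mul0r mulr0.
  rewrite EGr size_proper_mul; last first.
    by rewrite lead_coef_exp lead_coefXsubC expr1n mulr1 lead_coef_eq0.
  rewrite size_exp_XsubC addnS /= => sz; move: r0; rewrite -size_poly_gt0.
  by rewrite lt0n -(leqn0 (size r)) -(leq_add2r n.+1) add0n sz.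
case/allPn => u uf; rewrite -leqNgt => ltu.
have le_j : (3 * n.+1 <= u i1 + 2 * u i2)%N.
  move: ltu (wdeg_e u); rewrite degu // /e0.
  by move: (2 * m * d)%N => D; clear; lia.
(* Each index i satisfies i(2m+3) <= 2(3+im), with equality for i = 2. *)
have le_d : ((u i1 + 2 * u i2) * (2 * m + 3) <= 2 * d)%N.
  by rewrite -(degu _ uf) wdeg3 /w /curve_weight /=; clear; nia.
apply: leq_trans le_d; apply: leq_trans (leq_mul le_j (leqnn _)).
apply: leq_trans (leq_mul (leqnn _) (geq_minr _ _)) _.
by clear; nia.
Qed.

Lemma symbolic_piece_bound n d : has_nonzero_piece w (symbolic_power p n) d ->
  (n * minn (4 * m + 12) (6 * m + 9) <= 2 * d)%N.
Proof.
move=> [f [/theta_symbolic_power[q Eq] homf] f0].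
exact: weight_lower_bound f0 homf Eq.
Qed.

(** * Forms of small weight in the symbolic powers *)

Let p_conic : p conic.
Proof. by apply/pP; rewrite theta_conic hornerM hornerXsubC subrr mulr0. Qed.

Let conic_neq0 : conic != 0.
Proof.
apply/eqP => /(congr1 (meval (fun i => (i == i1)%:R))).
rewrite meval0 /conic expr2 mevalB !mevalM !mevalXU eqxx mulr1 mul0r subr0.
by move/eqP; rewrite oner_eq0.
Qed.

Lemma conic_piece n :
  has_nonzero_piece w (symbolic_power p n) (n * (2 * m + 6)).
Proof.
exists (conic ^+ n); last by rewrite expf_neq0.
split; last by rewrite mulnC; apply/dhomogMn/conic_homog.
apply/(symbolic_powerP _ _ _ _ p0 p1 pM); exists 1 => //.
by rewrite mul1r; apply: ideal_pow_expr.
Qed.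

Lemma alpha_monomial_curve_ideal : (0 < m)%N -> alpha w p = (2 * m + 6)%N.
Proof.
move=> m_gt0; have piece : has_nonzero_piece w p (2 * m + 6).
  by exists conic => //; split=> //; apply: conic_homog.
have [[f [pf homf] f0] le_alpha] := alphaP _ _ _ _ _ piece.
apply/eqP; rewrite eqn_leq le_alpha /=.
have /factor_theorem[q Eq] : root (theta f) 1 by apply/eqP/pP.
have := weight_lower_bound 1 f _ q f0 homf Eq.
(* For m = 1 the bound reads 15 <= 2a, and integrality gives a >= 8. *)
by rewrite mul1n; move: (alpha _ _) m_gt0 => a; clear; lia.
Qed.

Let p_x : ~ p x.
Proof.
rewrite pP theta_v1 mmapX mmap1U; apply/eqP.
by rewrite expf_neq0 // polyX_eq0.
Qed.

(** For m = 1 this form has weight 15 and [x * F] is a sum of two products of pairs of elements of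
    [p]. As [x] is not in [p], [F] lies in the second symbolic power. *)
Let F : {mpoly k[3]} := x ^+ 5 - 3%:R * x ^+ 2 * y * z + x * y ^+ 3 + z ^+ 3.

(** The witness is a power of [F], times one [conic] of weight 8 if [n] is odd; its weight is 15n/2
    rounded up. *)
Lemma weight15_piece n : m = 1%N ->
  has_nonzero_piece w (symbolic_power p n) (15 * n + 1)./2.
Proof.
move=> m1.
pose G2 : {mpoly k[3]} := x ^+ 3 - y * z.
pose G3 : {mpoly k[3]} := x ^+ 2 * y - z ^+ 2.
have EF : x * F = G2 ^+ 2 + conic * G3 by rewrite /F /conic /G2 /G3; ring.
have p_G2 : p G2.
  apply/pP; rewrite theta_v1 /G2 rmorphB rmorphXn rmorphM /= !mmapX !mmap1U.
  by rewrite /w m1 -!exprM -exprD subrr.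
have p_G3 : p G3.
  apply/pP; rewrite theta_v1 /G3 rmorphB rmorphM !rmorphXn /= !mmapX !mmap1U.
  by rewrite /w m1 -!exprM -exprD subrr.
have homF : F \is ishomog1 15 (wdeg w).
  have homM a b c : (3 * a + 4 * b + 5 * c = 15)%N ->
      x ^+ a * y ^+ b * z ^+ c \is ishomog1 15 (wdeg w).
    have -> : (3 * a + 4 * b + 5 * c = 3 * a + (3 + m) * b + (3 + 2 * m) * c)%N.
      by rewrite m1.
    by move=> <-; apply: dhomogM; [apply: dhomogM|]; apply: dhomogMn.
  have -> : F = x ^+ 5 * y ^+ 0 * z ^+ 0 - (x ^+ 2 * y ^+ 1 * z ^+ 1) *+ 3 +
      x ^+ 1 * y ^+ 3 * z ^+ 0 + x ^+ 0 * y ^+ 0 * z ^+ 3.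
    by rewrite /F; ring.
  by do 3?[apply: rpredD]; rewrite ?rpredN ?rpredMn ?homM.
have F0 : F != 0.
  (* At the point (0, 0, 1) only the term z^3 survives. *)
  apply/eqP => /(congr1 (meval (fun i => (i == i2)%:R))).
  rewrite meval0 /F !(mevalD, mevalN, mevalM, mevalXU).
  rewrite (_ : (ord0 == i2) = false) // (_ : (i1 == i2) = false) // eqxx /=.
  rewrite !(mul0r, mulr0, mulr1, oppr0, add0r, addr0) => /eqP.
  by rewrite oner_eq0.
(* Each factor [x * F] raises the power of [p] by two; the extra factor [f] makes room for
   [conic]. *)
have IF r f s : ideal_pow p s f -> ideal_pow p (2 * r + s) ((x * F) ^+ r * f).
  move=> If; elim: r => [|r IHr]; first by rewrite mul1r.
  set g := (x * F) ^+ r * f in IHr.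
  have -> : (x * F) ^+ r.+1 * f = g * G2 * G2 + g * conic * G3.
    by rewrite exprS -mulrA -/g EF; ring.
  have -> : (2 * r.+1 + s = (2 * r + s).+2)%N by lia.
  by apply: ideal_powD; apply: ideal_powM => //; apply: ideal_powM.
exists (F ^+ n./2 * conic ^+ odd n); last by rewrite mulf_neq0 ?expf_neq0.
split.
  (* The multiplier supplies one [x] for each [F]. *)
  apply/(symbolic_powerP _ _ _ _ p0 p1 pM); exists (x ^+ n./2).
    by elim: n./2 => [|r IHr]; rewrite ?exprS //; apply: pM.
  rewrite mulrA -exprMn.
  have := IF n./2 _ _ (ideal_pow_expr _ p conic (odd n) p_conic).
  by rewrite mul2n addnC odd_double_half.
have -> : ((15 * n + 1)./2 = 15 * n./2 + (2 * m + 6) * odd n)%N.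
  by rewrite m1 -{1}(odd_double_half n); clear; lia.
by apply: dhomogM; apply: dhomogMn => //; apply: conic_homog.
Qed.

End MonomialCurve.

(** * The Waldschmidt constant as a limit *)

Theorem theorem7p8 (R : realType) (k : fieldType) (m : nat)
    (m_ge1 : (1 <= m)%N) (co3m : coprime 3 m) :
  let w := curve_weight m in
  let p : set {mpoly k[3]} := monomial_curve_ideal w k in
  [/\ alpha w p = (2 * m + 6)%N,
      cvgn (waldschmidt_seq w R p) &
      waldschmidt w R p = if m == 1%N then 15 / 2 else (2 * m + 6)%:R].
Proof.
move=> w p.
(* [M] is twice the claimed constant, and equals the minimum in the lower bound since m >= 1. *)
pose M := if m == 1%N then 15%N else (4 * m + 12)%N.
have EM : M = minn (4 * m + 12) (6 * m + 9) by rewrite /M; case: eqP; lia.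
have bound n : (n * M <= 2 * alpha w (symbolic_power p n) <= n * M + 1)%N.
  have [piece _] := alphaP _ _ _ _ _ (conic_piece k m co3m n).
  rewrite EM (symbolic_piece_bound k m co3m _ _ piece) -EM /=.
  rewrite /M; case: (eqVneq m 1%N) => m1.
    have [_] := alphaP _ _ _ _ _ (weight15_piece k m co3m n m1).
    by rewrite -/w -/p; move: (alpha w _) => a; clear; lia.
  (* For m > 1 the powers of [conic] attain the bound exactly; only m = 1 needs the rounding
     term. *)
  have [_] := alphaP _ _ _ _ _ (conic_piece k m co3m n).
  by rewrite -/w -/p; move: (alpha w _) => a; clear; lia.
have lim := cvg_ratio_half R _ _ bound.
split; first exact: alpha_monomial_curve_ideal m_ge1.
  by apply/cvg_ex; exists (M%:R / 2).
rewrite /waldschmidt (cvg_lim _ lim) // /M; case: eqP => // _.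
by rewrite (_ : 4 * m + 12 = (2 * m + 6) * 2)%N ?natrM ?mulfK //; lia.
Qed.
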